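(* Let $G$ be a compact abelian group with discrete dual group $\Gamma$, let $E \subset \Gamma$ be uncountable, let $p$ be a prime number and $n \in \mathbb{N}$. Then $E$ contains a $p^n$-PR subset $F$ with $|F| = |E|$ if and only if $|\pi_{p^n}(E)| = |E|$.
   Context: Characters are written multiplicatively; $\mathbb{Z}_N$ is identified with the $N$-th roots of unity in the unit circle $\mathbb{T}$. A subset $E \subset \Gamma$ is $N$-PR if for every function $\varphi: E \to \mathbb{Z}_N$ there exists $x \in G$ with $\varphi(\gamma) = \gamma(x)$ for all $\gamma \in E$. Let $\Gamma_0$ be the torsion subgroup of $\Gamma$. For a prime $p$ and $n \in \mathbb{N}$, $\Gamma_{p^n}$ denotes the subgroup of $\Gamma_0$ consisting of the elements whose (finite) order is not divisible by $p^n$, and $\pi_{p^n}: \Gamma \to \Gamma/\Gamma_{p^n}$ is the quotient map. *)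

(* Defs.v *)
From HB Require Import structures.
From mathcomp Require Import all_boot all_algebra.
From mathcomp Require Import complex.
From mathcomp Require Import all_classical all_reals all_analysis.
Import numFieldNormedType.Exports.
Import GRing.Theory Num.Theory.

Set Implicit Arguments.
Unset Strict Implicit.
Unset Printing Implicit Defensive.

Local Open Scope classical_set_scope.
Local Open Scope ring_scope.

(* The circle group T is the unit circle of the complex numbers R[i]
   (R any realType, i.e. a model of the reals); R[i]^o carries the
   norm topology of C.  Characters are written multiplicatively. *)

Definition is_character (R : realType) (G : topologicalZmodType)
  (chi : G -> R[i]) : Prop :=
  [/\ continuous (chi : G -> R[i]^o),
      (forall x : G, `|chi x| = 1) &
      (forall x y : G, chi (x + y) = chi x * chi y)].

Definition dual (R : realType) (G : topologicalZmodType) : set (G -> R[i]) :=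
  [set chi | is_character chi].

Definition char_order (R : realType) (G : topologicalZmodType)
  (gamma : G -> R[i]) (k : nat) : Prop :=
  [/\ (0 < k)%N,
      (forall x, gamma x ^+ k = 1) &
      (forall j, (0 < j)%N -> (forall x, gamma x ^+ j = 1) -> (k <= j)%N)].

Definition Gamma_nd (R : realType) (G : topologicalZmodType) (m : nat)
  : set (G -> R[i]) :=
  [set gamma | @dual R G gamma /\
     exists k, char_order gamma k /\ ~~ (m %| k)%N].

Definition quot_map (R : realType) (G : topologicalZmodType) (m : nat)
  (gamma : G -> R[i]) : set (G -> R[i]) :=
  [set (fun x => gamma x * h x) | h in @Gamma_nd R G m].

Definition is_PR (R : realType) (G : topologicalZmodType) (N : nat)
  (E : set (G -> R[i])) : Prop :=
  forall phi : (G -> R[i]) -> R[i],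
    (forall gamma, E gamma -> phi gamma ^+ N = 1) ->
    exists x : G, forall gamma, E gamma -> phi gamma = gamma x.

(* Main.v *)
Require Import Defs.
From HB Require Import structures.
From mathcomp Require Import all_boot all_order all_algebra.
From mathcomp Require Import finmap complex.
From mathcomp Require Import all_classical all_reals all_analysis.
From mathcomp Require Import wochoice ring lra.
From mathcomp Require separable cyclotomic cyclic.
Import numFieldNormedType.Exports.
Import Order.TTheory GRing.Theory Num.Theory.
Local Open Scope classical_set_scope.
Local Open Scope card_scope.
Local Open Scope ring_scope.

(** If [F] is [p^n]-PR, two members of [F] in the same class modulo
    [Gamma_{p^n}] would differ by an [h] taking a primitive [p^n]-th root of
    unity as a value, so [p^n] would divide the order of [h].

    Conversely, well-order [E] and let [I] consist of those [gamma] in [E]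
    whose order modulo the subgroup generated by the earlier members of [I] is
    infinite or divisible by [p^n].  For any other [gamma] in [E] there is an [m]
    not divisible by [p^n] such that [gamma^m] is in the subgroup generated by
    [I], and [m] and [gamma^m] determine the class of [gamma] modulo
    [Gamma_{p^n}]; hence [|I| = |E|].  The
    relation expressing the order of [gamma] involves finitely many earlier
    members of [I], so following these relations downwards gives each [gamma]
    finitely many descendants.  An uncountable set contains a subset [F] of
    full cardinality in which no element is a descendant of another, and then
    every relation between members of [F] has all exponents divisible by
    [p^n].  Thus prescribing [p^n]-th roots of unity on [F] defines a
    homomorphism on the subgroup generated by [F].  By compactness it is the
    evaluation at a point as soon as it can be interpolated on finite sets,
    and this follows from comparing means of powers of trigonometric
    polynomials, as in Bohr's proof of Kronecker's theorem. *)

(** * Cardinals of infinite sets *)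

(** [M] need not be functional: choice picks one partner for each [x], so an injection can be
    described by a formula. *)
Lemma card_le_rel {T U} {A : set T} {B : set U} (M : T -> U -> Prop) :
    (forall x, A x -> exists2 y, B y & M x y) ->
    (forall x x' y, A x -> A x' -> M x y -> M x' y -> x = x') ->
  A #<= B.
Proof.
move=> totM injM; have [[x0 Ax0]|nA] := pselect (exists x, A x); last first.
  suff -> : A = set0 by exact: card_ge0.
  by apply/seteqP; split=> // x Ax; apply: nA; exists x.
have [y0 By0 _] := totM x0 Ax0.
have /boolp.choice[f fP] x : exists y, A x -> B y /\ M x y.
  by have [/totM[y By Mxy]|nAx] := pselect (A x); [exists y | exists y0].
have : $|{injfun A >-> B}|.
  apply/injfunPex; exists f; first by move=> x /fP[].
  move=> x x' /set_mem Ax /set_mem Ax' fxx'.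
  apply: (injM x x' (f x)) => //; first exact: (fP x Ax).2.
  by rewrite fxx'; exact: (fP x' Ax').2.
by case=> g; exact: inj_card_le g.
Qed.

Lemma card_le_fun {T U} {A : set T} {B : set U} (u0 : U) : A #<= B ->
  exists f : T -> U, (forall x, A x -> B (f x)) /\
    (forall x x', A x -> A x' -> f x = f x' -> x = x').
Proof.
move=> /card_leP[f].
pose g x := if pselect (A x) is left Ax then val (f (SigSub (mem_set Ax))) else u0.
have gE x (Ax : A x) : g x = val (f (SigSub (mem_set Ax))).
  rewrite /g; case: pselect => // Ax'; congr (val (f _)); exact/val_inj.
exists g; split=> [x Ax|x x' Ax Ax'].
  by rewrite (gE _ Ax); exact/set_mem/valP.
rewrite (gE _ Ax) (gE _ Ax') => /val_inj/inj.
by rewrite !inE => /(_ I I)/(congr1 val).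
Qed.

(** Zorn's lemma gives a maximal graph of a partial injection; it exhausts [A] or [B], since
    otherwise one more pair could be added. *)
Lemma card_le_total {T U} (A : set T) (B : set U) : A #<= B \/ B #<= A.
Proof.
pose P (M : set (T * U)) := [/\ forall p, M p -> A p.1 /\ B p.2,
  forall p q, M p -> M q -> p.1 = q.1 -> p = q &
  forall p q, M p -> M q -> p.2 = q.2 -> p = q].
have [F FP totF|M [[MAB Mf Mi] maxM]] := @Zorn_bigcup (T * U) P.
  have FF p q : (\bigcup_(X in F) X) p -> (\bigcup_(X in F) X) q ->
      exists X, [/\ F X, X p & X q].
    move=> [X FX Xp] [Y FY Yq].
    have [XY|YX] := totF _ _ FX FY; first by exists Y; split=> //; exact: XY.
    by exists X; split=> //; exact: YX.
  split.
  - by move=> p [X /FP[+ _ _]] => /[apply].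
  - by move=> p q Fp Fq; have [X [/FP[_ + _] Xp Xq]] := FF p q Fp Fq; exact.
  - by move=> p q Fp Fq; have [X [/FP[_ _ +] Xp Xq]] := FF p q Fp Fq; exact.
have [domA|/existsNP[x /not_implyP[Ax nx]]] :=
    pselect (forall x, A x -> exists y, M (x, y)).
  left; apply: (card_le_rel (fun x y => M (x, y))) => [a Aa|a a' b _ _ h h'].
    by have [y Mxy] := domA a Aa; exists y => //; exact: (MAB _ Mxy).2.
  by have [] := Mi _ _ h h' erefl.
have [domB|/existsNP[y /not_implyP[By ny]]] :=
    pselect (forall y, B y -> exists x, M (x, y)).
  right; apply: (card_le_rel (fun y x => M (x, y))) => [b Bb|a a' b _ _ h h'].
    by have [a Mxy] := domB b Bb; exists a => //; exact: (MAB _ Mxy).1.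

  by have [] := Mf _ _ h h' erefl.
exfalso; apply: (maxM (M `|` [set (x, y)])).
  rewrite properEneq; split; last by left.
  by apply/eqP => MM; apply: nx; exists y; rewrite MM; right.
split.
- by move=> p [/MAB//|->].
- move=> [p1 p2] [q1 q2] [Mp|[-> ->]] [Mq|[-> ->]] //= e.
  + exact: (Mf _ _ Mp Mq).
  + by exfalso; apply: nx; exists p2; rewrite -e.
  + by exfalso; apply: nx; exists q2; rewrite e.
- move=> [p1 p2] [q1 q2] [Mp|[-> ->]] [Mq|[-> ->]] //= e.
  + exact: (Mi _ _ Mp Mq).
  + by exfalso; apply: ny; exists p1; rewrite -e.
  + by exfalso; apply: ny; exists q1; rewrite e.
Qed.

Lemma infinite_injection {T} {A : set T} : infinite_set A ->
  exists e : nat -> T, (forall n, A (e n)) /\ injective e.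
Proof.
move=> infA; have [x0 _] := infinite_setN0 infA.
have /(card_le_fun x0)[e [eA ie]] := (infiniteP A).1 infA.
exists e; split=> [n|m n emn]; first exact: eA.
exact: ie.
Qed.

(** By Zorn's lemma, take a maximal infinite [X] inside [A] with an injective pairing. If the rest
    of [A] embeds in [X], so does [A]; otherwise a copy of [X] outside [X] enlarges the pairing. *)
Lemma infinite_pairing {T} {A : set T} : infinite_set A ->
  exists f : T -> T -> T, (forall x y, A x -> A y -> A (f x y)) /\
    (forall x y x' y', A x -> A y -> A x' -> A y' ->
       f x y = f x' y' -> x = x' /\ y = y').
Proof.
pose is_pairing (X : set T) (f : T -> T -> T) :=
  (forall x y, X x -> X y -> X (f x y)) /\
  (forall x y x' y', X x -> X y -> X x' -> X y' ->
       f x y = f x' y' -> x = x' /\ y = y').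
move=> infA; suff [X [f [XA infX [Xf fI] AX]]] : exists X f,
    [/\ X `<=` A, infinite_set X, is_pairing X f & A #<= X].
  have [x0 Xx0] := infinite_setN0 infX.
  have [h [hX hI]] := card_le_fun x0 AX.
  exists (fun x y => f (h x) (h y)); split=> [x y Ax Ay|x y x' y' Ax Ay Ax' Ay' ffE].
    by apply/XA/Xf; exact: hX.
  by case: (fI _ _ _ _ (hX _ Ax) (hX _ Ay) (hX _ Ax') (hX _ Ay') ffE) => e1 e2;
    split; exact: hI.
pose good (p : set T * (T -> T -> T)) :=
  [/\ p.1 `<=` A, infinite_set p.1 & is_pairing p.1 p.2].
have [p0 p0good] : exists p, good p.
  have [e [eA eI]] := infinite_injection infA.
  have /boolp.choice[d dP] (x : T) : exists n, (exists m, x = e m) -> x = e n.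
    by have [[m ->]|nm] := pselect (exists m, x = e m); [exists m|exists 0%N].
  have ed n : d (e n) = n by apply: eI; rewrite -dP //; exists n.
  (* The starting point is a countable subset, paired by a coding of pairs of natural numbers. *)
  exists (range e, fun x y => e (choice.pickle (d x, d y))); split=> /=.
  - by move=> _ [n _ <-].
  - apply/infiniteP/(card_le_rel (fun n x => x = e n)).
      by move=> n _; exists (e n) => //; exists n.
    by move=> n n' x _ _ -> /eI.
  - split=> [x y _ _|_ _ _ _ [x _ <-] [y _ <-] [x' _ <-] [y' _ <-]].
      by exists (choice.pickle (d x, d y)).
    rewrite !ed => /eI/(congr1 (choice.unpickle : nat -> option (nat * nat))).
    by rewrite !choice.pickleK => -[-> ->].
pose S := {p | good p}.
pose R : rel S := fun p q => `[< (sval p).1 `<=` (sval q).1 /\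
  forall x y, (sval p).1 x -> (sval p).1 y -> (sval p).2 x y = (sval q).2 x y >].
have [||C totC|[[X f] [/= XA0 infX0 [Xf0 fI0]]] maxXf] :=
    @ZL_preorder S (exist good p0 p0good) R.
- by move=> p; apply/asboolP; split.
- move=> p q r /asboolP[pq1 pq2] /asboolP[qr1 qr2]; apply/asboolP; split.
    exact: subset_trans qr1.
  by move=> x y px py; rewrite pq2 // qr2 //; exact: pq1.
- have [[q0 Cq0]|nC] := pselect (exists q, C q); last first.
    by exists (exist good p0 p0good) => s Cs; exfalso; apply: nC; exists s.
  pose X := [set x | exists2 p : S, C p & (sval p).1 x].
  have X2 x y : X x -> X y -> exists p : S, [/\ C p, (sval p).1 x & (sval p).1 y].
    move=> [p Cp px] [q Cq qy].
    have [/asboolP[pq _]|/asboolP[qp _]] := totC _ _ Cp Cq.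
      by exists q; split=> //; exact: pq.
    by exists p; split=> //; exact: qp.
  have X4 x y x' y' : X x -> X y -> X x' -> X y' -> exists p : S,
      [/\ C p, (sval p).1 x /\ (sval p).1 y & (sval p).1 x' /\ (sval p).1 y'].
    move=> Xx Xy Xx' Xy'; have [p [Cp px py]] := X2 x y Xx Xy.
    have [q [Cq qx qy]] := X2 x' y' Xx' Xy'.
    have [/asboolP[pq _]|/asboolP[qp _]] := totC _ _ Cp Cq.
      by exists q; split=> //; split; exact: pq.
    by exists p; split=> //; split; exact: qp.
  have /boolp.choice[f fP] (xy : T * T) : exists z, forall p : S, C p ->
      (sval p).1 xy.1 -> (sval p).1 xy.2 -> z = (sval p).2 xy.1 xy.2.
    have [[p [Cp px py]]|nxy] := pselect (exists p : S,
        [/\ C p, (sval p).1 xy.1 & (sval p).1 xy.2]); last first.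
      by exists xy.1 => p Cp px py; exfalso; apply: nxy; exists p.
    exists ((sval p).2 xy.1 xy.2) => q Cq qx qy.
    have [/asboolP[_ ->]//|/asboolP[_ -> //]] := totC _ _ Cp Cq.
  have gX : good (X, fun x y => f (x, y)).
    split=> /=.
    - by move=> x [[p pg] Cp /= px]; have [+ _ _] := pg; exact.
    - case: q0 Cq0 => q qg Cq; have [_ + _] := qg; apply: contra_not.
      by apply: sub_finite_set => x qx; exists (exist good q qg).
    - split=> [x y Xx Xy|x y x' y' Xx Xy Xx' Xy'].
        have [p [Cp px py]] := X2 x y Xx Xy; rewrite (fP (x, y) p) //=.
        by exists p => //; case: (svalP p) => _ _ [+ _]; exact.
      have [p [Cp [px py] [px' py']]] := X4 _ _ _ _ Xx Xy Xx' Xy'.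
      rewrite (fP (x, y) p) // (fP (x', y') p) //=.
      by case: (svalP p) => _ _ [_ +]; exact.
  exists (exist good _ gX) => p Cp; apply/asboolP; split=> /= [x px|x y px py].
    by exists p.
  by rewrite (fP (x, y) p).
have [XA infX Xf fI] := And4 XA0 infX0 Xf0 fI0.
exists X, f; split=> //; have [//|AX] := pselect (A #<= X); exfalso.
have [c [cX cI]] := infinite_injection infX.
have c01 : c 0%N <> c 1%N by move/cI.
have [hX|XAX] := card_le_total (A `\` X) X.
  have [h [hXX hI]] := card_le_fun (c 0%N) hX.
  (* The tags [c 0] and [c 1] keep the images of [X] and of its complement apart. *)
  apply: AX; apply: (card_le_rel (fun x y =>
    (X x /\ y = f x (c 0%N)) \/ (~ X x /\ y = f (h x) (c 1%N)))).
    move=> x Ax; have [Xx|nXx] := pselect (X x).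
      by exists (f x (c 0%N)); [exact: Xf|left].
    by exists (f (h x) (c 1%N)); [apply: Xf => //; exact: hXX|right].
  move=> x x' y Ax Ax' [[Xx ->]|[Xx ->]] [[Xx' e]|[Xx' e]].
  - by have [] := fI _ _ _ _ Xx (cX _) Xx' (cX _) e.
  - by have [_ /c01] := fI _ _ _ _ Xx (cX _) (hXX x' (conj Ax' Xx')) (cX _) e.
  - by have [_ /esym] := fI _ _ _ _ (hXX x (conj Ax Xx)) (cX _) Xx' (cX _) e.
  - have [] := fI _ _ _ _ (hXX x (conj Ax Xx)) (cX _) (hXX x' (conj Ax' Xx')) (cX _) e.
    by move=> hE _; apply: hI.
have [g [gX gI]] := card_le_fun (c 0%N) XAX.
(* [X'] adds to [X] a disjoint copy under [g]; [r] folds [X'] onto [X] and [b] records the side.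
   Pairs with a member outside [X] are coded in the copy, away from the old values. *)
pose X' := X `|` g @` X.
have /boolp.choice[r rP] (x : T) : exists y,
    (X x -> y = x) /\ (~ X x -> X' x -> X y /\ g y = x).
  have [Xx|nXx] := pselect (X x); first by exists x.
  have [[//|[y Xy gyx]]|nX'x] := pselect (X' x); last by exists x; split.
  by exists y.
have rX x : X' x -> X (r x).
  move=> X'x; have [Xx|nXx] := pselect (X x); first by rewrite (rP x).1.
  by have [] := (rP x).2 nXx X'x.
pose b x := if pselect (X x) is left _ then c 0%N else c 1%N.
have bX x : X (b x) by rewrite /b; case: pselect.
have rbI x y : X' x -> X' y -> r x = r y -> b x = b y -> x = y.
  rewrite /b => X'x X'y; case: pselect => Xx; case: pselect => Xy //.
  - by rewrite (rP x).1 // (rP y).1.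
  - by move=> _ /esym.
  - by case: ((rP x).2 Xx X'x) => _ {2}<- + _ => ->; case: ((rP y).2 Xy X'y).
pose f' x y := if pselect (X x /\ X y) is left _ then f x y
  else g (f (f (r x) (r y)) (f (b x) (b y))).
have ffX x y : X' x -> X' y -> X (f (f (r x) (r y)) (f (b x) (b y))).
  by move=> /rX rXx /rX rXy; exact: Xf (Xf _ _ rXx rXy) (Xf _ _ (bX x) (bX y)).
have f'X x y : X' x -> X' y -> X' (f' x y).
  move=> Xx Xy; rewrite /f'; case: pselect => [[]|_]; first by left; exact: Xf.
  by right; exists (f (f (r x) (r y)) (f (b x) (b y))) => //; exact: ffX.
have gdisj x : X x -> ~ X (g x) by move=> /gX[].
have gX' : good (X', f').
  split=> /=.
  - by move=> x [/XA//|[y /gX[? _] <-]].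
  - by move: infX; apply: contra_not; apply: sub_finite_set; left.
  - split=> // x y x' y' Xx Xy Xx' Xy'.
    rewrite /f'; case: pselect => [[? ?]|_]; case: pselect => [[? ?]|_].
    + exact: fI.
    + by move=> e; exfalso; apply: (gdisj _ (ffX x' y' Xx' Xy')); rewrite -e; exact: Xf.
    + by move=> e; exfalso; apply: (gdisj _ (ffX x y Xx Xy)); rewrite e; exact: Xf.
    move=> /(gI _ _ (ffX _ _ Xx Xy) (ffX _ _ Xx' Xy')).
    have rXx := rX _ Xx; have rXy := rX _ Xy.
    have rXx' := rX _ Xx'; have rXy' := rX _ Xy'.
    move=> /(fI _ _ _ _ (Xf _ _ rXx rXy) (Xf _ _ (bX _) (bX _))
      (Xf _ _ rXx' rXy') (Xf _ _ (bX _) (bX _)))[].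
    move=> /(fI _ _ _ _ rXx rXy rXx' rXy')[rx ry].
    move=> /(fI _ _ _ _ (bX _) (bX _) (bX _) (bX _))[bx by_].
    by split; exact: rbI.
have /asboolP[/= X'X _] : R (exist good _ gX')
    (exist good (X, f) (And3 XA0 infX0 (conj Xf0 fI0))).
  apply: maxXf; apply/asboolP; split=> /= [x Xx|x y Xx Xy]; first by left.
  by rewrite /f'; case: pselect => // -[].
by apply: (gdisj (c 0%N)) => //; apply: X'X; right; exists (c 0%N).
Qed.

(** A sequence is coded by its length and an iterated pairing; the length is needed because [e 0],
    the code of the empty sequence, may also be the code of a pair. *)
Lemma infinite_seq_card {T : eqType} {A : set T} : infinite_set A ->
  [set s : seq T | {subset s <= A}] #<= A.
Proof.
move=> infA; have [f [fA fI]] := infinite_pairing infA.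
have [e [eA eI]] := infinite_injection infA.
pose enc := foldr f (e 0%N).
have subA (x : T) s : {subset x :: s <= A} -> A x /\ {subset s <= A}.
  move=> sA; split; first by apply/set_mem/sA; rewrite inE eqxx.
  by move=> y ys; apply: sA; rewrite inE ys orbT.
have encA s : {subset s <= A} -> A (enc s).
  by elim: s => [_|x s IH /subA[Ax /IH As]] /=; [exact: eA|exact: fA].
apply: (card_le_rel (fun s y => y = f (e (size s)) (enc s))) => [s sA|s t _ sA tA ->].
  by exists (f (e (size s)) (enc s)) => //; apply: fA => //; exact: encA.
move=> /(fI _ _ _ _ (eA _) (encA _ sA) (eA _) (encA _ tA))[/eI].
elim: s t sA tA => [|x s IH] [|y t] //= /subA[Ax sA] /subA[Ay tA] [st].
move=> /(fI _ _ _ _ Ax (encA _ sA) Ay (encA _ tA))[-> est].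
by congr cons; exact: IH.
Qed.

Lemma bigcup_card_le {T U J} {A : set U} (I : set J) (C : J -> set T) :
    infinite_set A -> I #<= A -> (forall i, I i -> C i #<= A) ->
  \bigcup_(i in I) C i #<= A.
Proof.
move=> infA IA CA; have [f [fA fI]] := infinite_pairing infA.
have [a0 _] := infinite_setN0 infA.
have [g [gA gI]] := card_le_fun a0 IA.
have /boolp.choice[h hP] (i : J) : exists h : T -> U, I i ->
    (forall x, C i x -> A (h x)) /\
    (forall x x', C i x -> C i x' -> h x = h x' -> x = x').
  have [/CA/(card_le_fun a0)[h hP]|nIi] := pselect (I i); first by exists h.
  by exists (fun=> a0).
apply: (card_le_rel (fun x y => exists i, [/\ I i, C i x & y = f (g i) (h i x)])).
  move=> x [i Ii Cix]; exists (f (g i) (h i x)); last by exists i.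
  by apply: fA; [exact: gA|exact: (hP i Ii).1].
move=> x x' y _ _ [i [Ii Cix ->]] [i' [Ii' Cix' e]].
have [hA hI] := hP i Ii; have [hA' _] := hP i' Ii'.
have [/(gI _ _ Ii Ii')ii' hxx'] := fI _ _ _ _ (gA _ Ii) (hA _ Cix) (gA _ Ii') (hA' _ Cix') e.
by rewrite -ii' in Cix' hxx'; exact: hI.
Qed.

Lemma setU_card_le {T U} {A : set U} (B C : set T) :
  infinite_set A -> B #<= A -> C #<= A -> B `|` C #<= A.
Proof.
move=> infA BA CA; rewrite -bigcup2E; apply: bigcup_card_le => // [|[|[|n]] _] //.
exact/infiniteP.
Qed.

Lemma countable_card_le {T U} {A : set U} (B : set T) :
  infinite_set A -> countable B -> B #<= A.
Proof. by move=> /infiniteP + cB; exact: card_le_trans. Qed.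

(** * Free subsets *)

(** There are at most [|D|] finite traces. Read contrapositively: if [C] does not embed in [D], the
    elements sharing some one trace already fail to embed. *)
Lemma finite_trace_card {T : eqType} {D : set T} (c : T -> set T) (C : set T) :
    infinite_set D -> (forall x, C x -> finite_set (c x `&` D)) ->
    (forall s, finite_set s -> s `<=` D -> C `&` [set x | c x `&` D = s] #<= D) ->
  C #<= D.
Proof.
move=> infD cfin CsD.
suff : \bigcup_(s in [set s : seq T | {subset s <= D}])
    (C `&` [set x | c x `&` D = [set` s]]) #<= D.
  apply: card_le_trans; apply: subset_card_le => x Cx.
  have /finite_seqP[s sE] := cfin x Cx.
  exists s => // y ys; apply/mem_set.
  by have [] : (c x `&` D) y by rewrite sE.
apply: bigcup_card_le => // [|s sD]; first exact: infinite_seq_card.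
by apply: CsD; [exact: finite_seq|move=> x /sD/set_mem].
Qed.

(* For uncountable sets of countable cofinality no level need be large: then
   levels of increasing size are thinned out until all their members have the
   same finite set of descendants in the lower levels retained so far. *)
Lemma free_subset {T : eqType} (I : set T) (ht : T -> nat) (c : T -> set T) :
    (forall x, I x -> finite_set (c x)) ->
    (forall x y, I x -> c x y -> y <> x -> (ht y < ht x)%N) -> ~ countable I ->
  exists F, [/\ F `<=` I, F #= I & forall x y, F x -> F y -> c x y -> x = y].
Proof.
move=> cfin cht uncI.
pose C n := I `&` [set x | ht x = n]; pose D n := I `&` [set x | (ht x <= n)%N].
have CI n : C n `<=` I by move=> x [].
have DI n : D n `<=` I by move=> x [].
(* A single level is free, because proper descendants have smaller height. *)
have [[n IC]|nIC] := pselect (exists n, I #<= C n).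
  exists (C n); split=> //; first by rewrite card_eq_le IC subset_card_le.
  move=> x y [Ix hx] [Iy hy] cxy; apply: contrapT => /nesym/(cht _ _ Ix cxy).
  by rewrite hx hy ltnn.
have DleC n : exists j, infinite_set (D n) -> D n #<= C j.
  have [j Cj] : exists j, forall i, (i <= n)%N -> C i #<= C j.
    elim: n => [|n [j Cj]]; first by exists 0%N => i; rewrite leqn0 => /eqP ->.
    have [CC|CC] := card_le_total (C j) (C n.+1).
      exists n.+1 => i; rewrite leq_eqVlt => /predU1P[->//|/Cj].
      by move/card_le_trans; apply.
    by exists j => i; rewrite leq_eqVlt => /predU1P[->//|/Cj].
  exists j => infD; have DE : D n = \bigcup_(i in `I_n.+1) C i.
    by apply/seteqP; split=> [x [Ix hx]|x [i /= hi [Ix hx]]];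
      [exists (ht x)|split; rewrite //= hx].
  have infC : infinite_set (C j).
    apply: contra_not infD => finC; rewrite DE; apply: bigcup_finite => // i /Cj.
    by move/card_le_finite; apply.
  rewrite DE; apply: bigcup_card_le => //.
  by apply: countable_card_le => //; exact: finite_set_countable.
have IE : I = \bigcup_i C i by apply/seteqP; split=> [x Ix|x [i _ []]//]; exists (ht x).
have IE' : I = \bigcup_i D i.
  by apply/seteqP; split=> [x Ix|x [i _ []]//]; exists (ht x) => //; split=> /=.
have [n0 infD0] : exists n0, infinite_set (D n0).
  apply/existsNP => finD; apply: uncI; rewrite IE'.
  by apply: bigcup_countable => // i _; exact: finite_set_countable.
have Dmono m n : (m <= n)%N -> D m `<=` D n.
  by move=> mn x [Ix hx]; split=> //; exact: leq_trans mn.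
have infD n : (n0 <= n)%N -> infinite_set (D n).
  by move=> nn; apply: contra_not infD0; apply: sub_finite_set; exact: Dmono.
(* If all levels above [n] embedded in [D n], so would the countable union of all levels, and [I]
   would embed in a single level. *)
have /boolp.choice[m mP] n : exists m, (n0 <= n)%N ->
    (n < m)%N /\ ~ (C m #<= D n).
  have [n0n|_] := leqP n0 n; last by exists 0%N.
  apply: contrapT => /forallNP allC; have [j Dj] := DleC n.
  apply: nIC; exists j; apply: card_le_trans (Dj (infD _ n0n)).
  rewrite IE; apply: bigcup_card_le => [||i _]; first exact: infD.
    by apply/infiniteP; exact: infD.
  have [ni|ni] := ltnP n i; last by apply: subset_card_le => x [Ix hx]; split; rewrite //= hx.
  by apply: contrapT => nCD; apply: (allC i).
pose k i := iter i m n0.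
have k0 i : (n0 <= k i)%N.
  by elim: i => // i IH; rewrite (leq_trans IH) // ltnW // (mP _ IH).1.
have kS i : (k i < k i.+1)%N by exact: (mP _ (k0 i)).1.
have kmono : {homo k : i j / (i <= j)%N}
  by apply: homo_leq => // [? ? ?|i]; [exact: leq_trans|exact: ltnW].
have kstrict : {homo k : i j / (i < j)%N} by move=> i j /kmono; exact: leq_trans.
(* Level [k i.+1] is larger than [D (k i)], so one finite trace [s i] is shared by too many of its
   members to embed in [D (k i)]. *)
have /boolp.choice[s sP] i : exists s, [/\ finite_set s, s `<=` D (k i) &
    ~ (C (k i.+1) `&` [set x | c x `&` D (k i) = s] #<= D (k i))].
  apply: contrapT => /forallNP alls; have [_] := mP _ (k0 i); apply.
  apply: (@finite_trace_card _ _ c) => [|x [Ix _]|t tfin tD]; first exact: infD.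
    exact/finite_setIl/cfin.
  by apply: contrapT => nCD; apply: (alls t).
pose P i := C (k i.+1) `&` [set x | c x `&` D (k i) = s i].
(* This union is countable, so removing it from [P i] leaves at least [|D (k i)|] elements. *)
pose Rt := \bigcup_i s i.
have cRt : countable Rt.
  by apply: bigcup_countable => // i _; apply: finite_set_countable; case: (sP i).
have DP i : D (k i) #<= P i `\` Rt.
  have [//|PD] := card_le_total (D (k i)) (P i `\` Rt).
  exfalso; have [_ _] := sP i; apply; apply: (@card_le_trans _ _ _ ((P i `\` Rt) `|` Rt)).
    by apply: subset_card_le => x Px; have [?|?] := pselect (Rt x); [right|left].
  by apply: setU_card_le => //; [exact: infD|apply: countable_card_le => //; exact: infD].
exists (\bigcup_i (P i `\` Rt)).
have FI : \bigcup_i (P i `\` Rt) `<=` I by move=> x [i _ [[[]]]].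
split=> //; first rewrite card_eq_le subset_card_le //=.
  have [x0 _] := infinite_setN0 infD0.
  have /boolp.choice[h hP] i := card_le_fun x0 (DP i).
  have /boolp.choice[l lP] x : exists i, I x -> D (k i) x.
    exists (ht x) => Ix; split=> //=.
    by elim: (ht x) => // n IH; exact: leq_ltn_trans (kS n).
  (* The stage [l x] can be read off the height [k (l x).+1] of the image, so the injections of the
     stages combine into one. *)
  apply: (card_le_rel (fun x y => y = h (l x) x)) => [x Ix|x x' y Ix Ix' ->].
    by exists (h (l x) x) => //; exists (l x) => //; apply: (hP _).1; exact: lP.
  have [[[_ /= hx] _] _] := (hP _).1 x (lP x Ix).
  have [[[_ /= hx'] _] _] := (hP _).1 x' (lP x' Ix').
  move=> hE; have lE : l x = l x'.
    have le_k i j : k i.+1 = k j.+1 -> (i <= j)%N.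
      by move=> kE; rewrite leqNgt; apply/negP => /(kstrict j.+1 i.+1); rewrite kE ltnn.
    have kE : k (l x).+1 = k (l x').+1 by exact: etrans (esym hx) (etrans (congr1 ht hE) hx').
    by apply/eqP; rewrite eqn_leq !le_k.
  have Dx' := lP x' Ix'; rewrite -lE in Dx' hE.
  exact: (hP _).2 (lP x Ix) Dx' hE.
(* A proper descendant [y] of [x] is lower, hence in [D (k i)], hence in the trace [s i], which was
   removed. *)
move=> x y [i _ [[[Ix hx] cx] _]] [j _ [[[Iy hy] _] nRy]] cxy.
apply: contrapT => /nesym/(cht _ _ Ix cxy); rewrite hx hy => kji.
apply: nRy; exists i => //; rewrite -cx; split=> //; split=> //=; rewrite hy.
apply: (kmono j.+1 i); rewrite ltnNge; apply/negP => ij.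
by move: kji; rewrite ltnNge (kmono i.+1 j.+1).
Qed.

(** * Independence modulo an integer *)

Inductive zspan {V : zmodType} (S : set V) : V -> Prop :=
| zspan0 : zspan S 0
| zspanS x y k : S x -> zspan S y -> zspan S (x *~ k + y).

Section Span.
Context {V : zmodType}.
Implicit Types (S : set V) (x y : V).

Lemma zspan_gen S x : S x -> zspan S x.
Proof. by move=> Sx; have := zspanS S x 0 1 Sx (zspan0 S); rewrite addr0. Qed.

Lemma zspanD S x y : zspan S x -> zspan S y -> zspan S (x + y).
Proof.
by elim=> [|u v k Su _ IH] Sy; rewrite ?add0r // -addrA; apply: zspanS => //; exact: IH.
Qed.

Lemma zspanMz S x (k : int) : zspan S x -> zspan S (x *~ k).
Proof.
elim=> [|u v l Su _ IH]; first by rewrite mul0rz; exact: zspan0.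
by rewrite mulrzDl -mulrzA; exact: zspanS.
Qed.

Lemma zspanN S x : zspan S x -> zspan S (- x).
Proof. by move=> /(@zspanMz _ _ (-1)); rewrite mulrN1z. Qed.

Lemma zspanB S x y : zspan S x -> zspan S y -> zspan S (x - y).
Proof. by move=> Sx /zspanN; exact: zspanD. Qed.

Lemma zspan_sub S S' x : S `<=` S' -> zspan S x -> zspan S' x.
Proof.
by move=> SS'; elim=> [|u v k Su _ IH]; [exact: zspan0|apply: zspanS => //; exact: SS'].
Qed.

Lemma zspan_finite S x : zspan S x ->
  exists T, [/\ finite_set T, T `<=` S & zspan T x].
Proof.
elim=> [|u v k Su _ [T [finT TS Tv]]]; first by exists set0; split=> //; exact: zspan0.
exists (u |` T); split=> [|y [->//|/TS//]|]; first by rewrite finite_setU.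
by apply: zspanS; [left|apply: zspan_sub Tv; right].
Qed.

Lemma zspan_card_le {U} {A : set U} S : infinite_set A -> S #<= A -> zspan S #<= A.
Proof.
move=> infA SA.
pose L := fix L n := if n is n'.+1 then
  \bigcup_(k : int) \bigcup_(x in S) ((fun y => x *~ k + y) @` L n') else [set 0].
have intA : [set: int] #<= A by apply: countable_card_le => //; exact: countableP.
have LA n : L n #<= A.
  elim: n => [|n IH] /=; first by apply: countable_card_le => //; exact: countable1.
  apply: bigcup_card_le => // k _; apply: bigcup_card_le => // x Sx.
  exact: card_le_trans (card_image_le _ _) IH.
suff -> : zspan S = \bigcup_n L n.
  by apply: bigcup_card_le => //; exact/infiniteP.
apply/seteqP; split=> [x|x [n _]].
  elim=> [|u v k Su _ [n _ Lv]]; first by exists 0%N.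
  by exists n.+1 => //=; exists k => //; exists u => //; exists v.
elim: n x => [_ ->|n IH x /= [k _ [u Su [v /IH Sv <-]]]]; first exact: zspan0.
exact: zspanS.
Qed.

Lemma zspan_image {W : zmodType} (f : {additive V -> W}) S x :
  zspan S x -> zspan (f @` S) (f x).
Proof.
elim=> [|u v k Su _ IH]; first by rewrite raddf0; exact: zspan0.
by rewrite raddfD raddfMz; apply: zspanS => //; exists u.
Qed.

End Span.

(** Well-foundedness excludes cycles of length two and three; together with trichotomy this gives
    transitivity. *)
Lemma exists_strict_well_order (T : eqType) : exists lt : T -> T -> Prop,
  [/\ well_founded lt, forall x y z, lt x y -> lt y z -> lt x z &
     forall x y, [\/ lt x y, x = y | lt y x]].
Proof.
have [R wo] := well_ordering_principle T.
pose lt x y := is_true (~~ R y x).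
have wf : well_founded lt.
  move=> x; apply: contrapT => nAcc.
  have [|z [[zA zmin] _]] := wo (fun x => `[< ~ Acc lt x >]).
    by exists x; apply/asboolP.
  move/asboolP: zA; apply; constructor => y; rewrite /lt => nRzy.
  by apply: contrapT => nAy; move/negP: nRzy; apply; apply: zmin; apply/asboolP.
have tri x y : [\/ lt x y, x = y | lt y x].
  rewrite /lt; case: (boolP (R x y)) => Rxy; last by constructor 3.
  case: (boolP (R y x)) => Ryx; last by constructor 1.
  constructor 2; have [|z [[zA zmin] zu]] := wo (pred2 x y).
    by exists x; rewrite inE eqxx.
  have [Rxx Ryy] : R x x /\ R y y.
    split; [have [|w [[]]] := wo (pred1 x)|have [|w [[]]] := wo (pred1 y)];
      try (by [exists x; rewrite inE|exists y; rewrite inE]);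
      by rewrite inE => /eqP -> + _; apply; rewrite inE.
  rewrite -(zu x) ?(zu y) //; split; rewrite ?inE ?eqxx ?orbT // => w;
    by rewrite inE => /orP[]/eqP ->.
exists lt; split=> // x y z xy yz.
have no3 : forall a b c, lt a b -> lt b c -> lt c a -> False.
  by move=> a; elim/(well_founded_ind wf): a => a IH b c ab bc ca;
    exact: (IH _ ca _ _ ca ab bc).
have [//|xz|/(no3 _ _ _ xy yz)//] := tri x z.
have no2 : forall a b, lt a b -> lt b a -> False.
  by move=> a; elim/(well_founded_ind wf): a => a IH b ab ba; exact: (IH _ ba _ ba ab).
by case: (no2 x y); rewrite // xz.
Qed.

(** Allows the membership of [x] to be decided from the members already chosen before it. *)
Lemma wf_recursive_set {T : Type} {lt : T -> T -> Prop} (P : T -> set T -> Prop) :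
  well_founded lt -> exists I : set T, forall x, I x = P x [set y | lt y x /\ I y].
Proof.
move=> wf.
pose F x (rec : forall y, lt y x -> Prop) := P x [set y | exists yx : lt y x, rec y yx].
exists (Fix wf (fun=> Prop) F) => x.
rewrite {1}Fix_eq => [|{}x f g fg]; rewrite /F.
  by congr (P _ _); apply/seteqP; split=> [y [? ?]|y [yx ?]]; [split|exists yx].
by congr (P _ _); apply/seteqP; split=> y /= [yx ?]; exists yx; [rewrite -fg|rewrite fg].
Qed.

(** [m] is the order of [x] modulo the span, with [0] standing for infinite order, so that one
    divisibility covers both cases. *)
Lemma zspan_order {V : zmodType} (S : set V) x : exists m : nat,
  zspan S (x *+ m) /\ forall k : int, zspan S (x *~ k) -> (m %| k)%Z.
Proof.
have zspanA (k : int) : zspan S (x *~ k) -> zspan S (x *+ `|k|%N).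
  rewrite -[_ *+ `|k|%N]/(x *~ `|k|%N%:Z) abszE => xk.
  by have [k0|k0] := ger0P k; rewrite ?mulrNz //; exact: zspanN.
have [[m /andP[m0 /asboolP xm]]|nm] :=
    pselect (exists m : nat, (0 < m)%N && `[< zspan S (x *+ m) >]); last first.
  exists 0%N; split=> [|k xk]; first exact: zspan0.
  rewrite dvd0z; apply: contrapT => /negP k0; apply: nm; exists `|k|%N.
  by rewrite absz_gt0 k0; apply/asboolP/zspanA.
have ex : exists m : nat, (0 < m)%N && `[< zspan S (x *+ m) >].
  by exists m; rewrite m0; apply/asboolP.
case: (ex_minnP ex) => {m0 xm}m /andP[m0 /asboolP xm] mmin.
exists m; split=> // k xk; rewrite dvdz_eq; apply/eqP.
have mz0 : m%:Z != 0 by rewrite eqz_nat -lt0n.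
have kE := divz_eq k m; rewrite {2}kE.
suff -> : (k %% m)%Z = 0 by rewrite addr0.
have xr : zspan S (x *~ (k %% m)%Z).
  have -> : (k %% m)%Z = k - (k %/ m)%Z * m by rewrite {2}kE addrC addKr.
  by rewrite mulrzBr mulrC mulrzA; apply: zspanB => //; exact: zspanMz.
apply/eqP; rewrite -absz_eq0; apply: contrapT => /negP r0.
have := mmin `|(k %% m)%Z|%N; rewrite lt0n r0; apply/not_implyP; split.
  exact/asboolP/zspanA.
apply/negP; rewrite -ltnNge -ltz_nat abszE ger0_norm ?modz_ge0 //.
exact: ltz_pmod.
Qed.

(** Collecting terms isolates the largest generator of a combination, so that relations can be
    treated by induction on it. *)
Lemma zspan_max {U : Type} {V : zmodType} {lt : U -> U -> Prop} (g : U -> V) (S : set U) v :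
    (forall x y z, lt x y -> lt y z -> lt x z) ->
    (forall x y, [\/ lt x y, x = y | lt y x]) ->
  zspan (g @` S) v -> v = 0 \/ exists x k u,
    [/\ S x, zspan (g @` [set y | S y /\ lt y x]) u & v = g x *~ k + u].
Proof.
move=> trans tri; elim=> [|_ y k [x Sx <-] _ [->|[z [l [u [Sz zu ->]]]]]]; first by left.
  by right; exists x, k, 0; split=> //; exact: zspan0.
right; have [xz|->|zx] := tri x z.
- exists z, l, (g x *~ k + u); split=> //; last by rewrite addrCA.
  by apply: zspanS => //; exists x.
- by exists z, (k + l), u; split=> //; rewrite mulrzDr addrA.
- exists x, k, (g z *~ l + u); split=> //; apply: zspanS; first by exists z.
  by apply: zspan_sub zu; apply: image_subset => w [Sw wz]; split=> //; exact: trans wz zx.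
Qed.

Inductive descendant {T : Type} (f : T -> set T) : T -> T -> Prop :=
| descendant_refl x : descendant f x x
| descendant_step x y z : f x y -> descendant f y z -> descendant f x z.

Lemma descendant_trans {T : Type} (f : T -> set T) x y z :
  descendant f x y -> descendant f y z -> descendant f x z.
Proof. by elim=> // {}x {}y t fxy _ IH /IH; exact: descendant_step. Qed.

(** By well-founded induction: besides [x] itself there are only the descendants of its finitely
    many successors, which are all earlier. *)
Lemma descendant_finite {T : Type} {lt : T -> T -> Prop} (f : T -> set T) :
    well_founded lt -> (forall x y, f x y -> lt y x) ->
    (forall x, finite_set (f x)) -> forall x, finite_set (descendant f x).
Proof.
move=> wf flt ffin x; elim/(well_founded_ind wf): x => x IH.
suff -> : descendant f x = x |` \bigcup_(y in f x) descendant f y.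
  by rewrite finite_setU; split=> //; apply: bigcup_finite => // y /flt/IH.
apply/seteqP; split=> [y|y [->|[z fxz zy]]].
- by move=> xy; case: xy flt IH => {y} [y|{}x y z fxy yz] _ _; [left|right; exists y].
- exact: descendant_refl.
- exact: descendant_step zy.
Qed.

(* The graph of [phi] generates the subgroup of all pairs formed by a
   combination of members of [F] and the same combination of the values of
   [phi]; the last clause thus says that the relations between members of [F]
   are sent by [phi] to multiples of [N]. *)
Lemma independent_subset {V : zmodType} {W : Type} (q : V -> W) (N : nat) (E : set V) :
    (forall x y m, ~~ (N %| m)%N -> (x - y) *+ m = 0 -> q x = q y) ->
    ~ countable E -> E #<= q @` E ->
  exists F : set V, [/\ F `<=` E, F #= E & forall phi : V -> int,
    (forall x, ~ F x -> phi x = 0) ->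
    forall a, zspan [set (x, phi x) | x in F] (0, a) -> (N %| a)%Z].
Proof.
move=> qE uncE EqE; have [lt [wf trans tri]] := exists_strict_well_order V.
have irr x : ~ lt x x by elim/(well_founded_ind wf): x => x IH xx; exact: (IH _ xx).
(* Asking for the divisibility of every [m] includes infinite order, where only [m = 0] occurs. *)
have [I IE] := wf_recursive_set
  (fun x S => E x /\ forall m, zspan S (x *+ m) -> (N %| m)%N) wf.
pose B x := [set y | lt y x /\ I y].
have subIE : I `<=` E by move=> x; rewrite IE => -[].
have cardE (U : Type) (A : set U) : infinite_set A -> I #<= A -> E #<= A.
  move=> infA IA; apply: card_le_trans EqE _.
  (* For [x] in [E] outside [I], the class [q x] is determined by some [m] and by [x *+ m]: there
     are countably many choices of the first and at most [|A|] of the second. *)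
  apply: (@card_le_trans _ _ _ (q @` I `|` \bigcup_(m in [set m | ~~ (N %| m)%N])
      [set w | exists2 x, zspan I (x *+ m) & q x = w])).
    apply: subset_card_le => _ [x Ex <-].
    have [Ix|nIx] := pselect (I x); first by left; exists x.
    right; move: nIx; rewrite IE => /not_andP[//|/existsNP[m /not_implyP[xm /negP Nm]]].
    by exists m => //; exists x => //; apply: zspan_sub xm => y [].
  apply: setU_card_le => //; first exact: card_le_trans (card_image_le _ _) IA.
  apply: bigcup_card_le => // [|m Nm].
    by apply: countable_card_le => //; exact: countableP.
  apply: card_le_trans (zspan_card_le I infA IA).
  apply: (card_le_rel (fun w y => exists2 x, q x = w & x *+ m = y)).
    by move=> w [x xm qx]; exists (x *+ m) => //; exists x.
  move=> w w' _ _ _ [x <- <-] [x' <- xx']; apply: (qE _ _ m) => //.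
  by rewrite mulrnBl xx' subrr.
have uncI : ~ countable I.
  by move=> cI; apply: uncE; apply: cardE => //; exact: infinite_nat.
have infI : infinite_set I by move=> /finite_set_countable.
have EI : E #<= I by exact: cardE.
have /boolp.choice[p pP] x : exists p : nat * set V,
    [/\ forall k : int, zspan (B x) (x *~ k) -> (p.1 %| k)%Z,
        finite_set p.2, p.2 `<=` B x & zspan p.2 (x *+ p.1)].
  have [m [/zspan_finite[S [finS SB Sm]] xk]] := zspan_order (B x) x.
  by exists (m, S).
pose f x := (p x).2.
have fB x : f x `<=` B x by case: (pP x).
pose c := descendant f.
have cfin x : finite_set (c x).
  by apply: descendant_finite wf _ _ x => [x y /fB[]|x] //; case: (pP x).
have clt x y : c x y -> y = x \/ lt y x.
  elim=> [|{}x z {}y /fB[zx _] _ [->|yz]]; [by left|by right|right].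
  exact: trans yz zx.
have cI x y : I x -> c x y -> I y.
  by move=> Ix cxy; elim: cxy Ix => // {}x z {}y /fB[_ Iz] _ IH _; exact: IH.
have [F [FI FcI Ffree]] : exists F, [/\ F `<=` I, F #= I &
    forall x y, F x -> F y -> c x y -> x = y].
  (* The height is the number of descendants: those of [y] are among those of [x] but do not include
     [x]. *)
  apply: (@free_subset _ _ (fun x => #|` fset_set (c x)|%fset)) => // x y _ cxy yx.
  apply: fproper_ltn_card; rewrite fproperE; apply/andP; split.
    apply/fsubsetP => z; rewrite !in_fset_set // !inE; exact: descendant_trans.
  apply/negP => /fsubsetP/(_ x); rewrite !in_fset_set // !inE.
  move=> /(_ (descendant_refl _ _))/clt[/esym//|xy].
  by have [//|yx'] := clt _ _ cxy; apply: (irr x); exact: trans yx'.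
exists F; split; first exact: subset_trans subIE.
  by apply: card_eq_trans FcI _; rewrite card_eq_le EI subset_card_le.
move=> phi phi0; pose S := \bigcup_(x in F) c x.
have SI : S `<=` I by move=> y [x /FI Ix]; exact: cI.
pose g x := (x, phi x).
pose G x := g @` [set y | S y /\ lt y x].
have pairz (x : V) (y k : int) : (x, y) *~ k = (x *~ k, y *~ k).
  by case: k => n; rewrite ?NegzE ?mulrNz -!pmulrn pairMnE.
(* Such a [z] is a proper descendant of a member of [F], so it is not in [F] and [phi] vanishes
   there. *)
have fphi x z : S x -> f x z -> S z /\ phi z = 0.
  move=> [y Fy yx] xz; have yz : c y z.
    by apply: descendant_trans yx _; exact: descendant_step (descendant_refl _ _).
  split; first by exists y.
  apply: phi0 => Fz; have yzE := Ffree _ _ Fy Fz yz; have [zx _] := fB _ _ xz.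
  have [xy|xy] := clt _ _ yx; apply: (irr z); rewrite -yzE in zx *.
    by rewrite xy in zx.
  exact: trans zx xy.
(* Induction on the largest generator [x]. The first coordinate gives [m %| k], and [N %| m], so the
   contribution of [x] to [a] is divisible by [N]. Replacing [x *+ m] by its expression in [f x],
   where [phi] is zero, leaves a relation between strictly earlier generators. *)
have step x k u a : S x -> zspan (G x) u -> (0, a) = g x *~ k + u ->
    (N %| a)%Z.
  elim/(well_founded_ind wf): x k u a => x IH k [u1 u2] a Sx Gu.
  have [mk _ _ fm] := pP x; move: mk fm; set m := (p x).1 => mk fm.
  rewrite /g pairz => -[xk ->].
  have u1E : u1 = - (x *~ k) by apply/eqP; rewrite -addr_eq0 addrC -xk.
  have /dvdzP[l kE] : (m %| k)%Z.
    apply: mk; rewrite -[x *~ k]opprK -u1E; apply: zspanN.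
    have := zspan_image (@fst V int) _ _ Gu; apply: zspan_sub => _ [_ [y [Sy yx] <-] <-].
    by split=> //; exact: SI.
  have Nm : (N %| m)%N.
    have := SI _ Sx; rewrite IE => -[_]; apply; apply: zspan_sub fm; exact: fB.
  apply: rpredD.
    by rewrite kE mulrzA -mulrzr intz; apply: dvdz_mull; rewrite dvdzE.
  have fG v : zspan (f x) v -> zspan (G x) (v, 0).
    elim=> [|z w n fz _ IHw]; first exact: zspan0.
    have -> : (z *~ n + w, 0) = (z, 0) *~ n + (w, 0) :> V * int.
      by rewrite pairz mul0rz; congr pair; rewrite addr0.
    apply: zspanS => //; have [Sz z0] := fphi _ _ Sx fz.
    by exists z; [split=> //; case: (fB _ _ fz)|rewrite /g z0].
  have Gu2 : zspan (G x) (0, u2).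
    have -> : (0, u2) = (u1, u2) + (x *+ m, 0) *~ l :> V * int.
      by rewrite pairz u1E kE mul0rz mulrC mulrzA; congr pair; rewrite /= ?addNr ?addr0.
    by apply: zspanD => //; apply: zspanMz; exact: fG.
  have [[->]|[y [n [w [[Sy yx] wG wE]]]]] := zspan_max g _ _ trans tri Gu2.
    exact: dvdz0.
  apply: (IH y yx n w) => //; apply: zspan_sub wG; apply: image_subset => z [[Sz _] zy].
  by split.
move=> a Fa; have : zspan (g @` S) (0, a).
  apply: zspan_sub Fa; apply: image_subset => x Fx; exists x => //.
  exact: descendant_refl.
by move=> /(zspan_max g _ _ trans tri)[[->]|[x [k [u [Sx Gu aE]]]]];
  [exact: dvdz0|exact: step Gu aE].
Qed.

(** * Partial homomorphisms on the dual group *)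

Section UnitComplex.
Context {R : realType}.
Implicit Types (w : R[i]).

Lemma complex_archimedean (x e : R[i]) : 0 <= x -> 0 < e ->
  exists2 n : nat, (0 < n)%N & x <= e * n%:R.
Proof.
case: x e => [a b] [c d]; rewrite lecE ltcE /= => /andP[/eqP -> a0] /andP[/eqP -> c0].
have [n an] : exists n : nat, a / c < n%:R.
  exists (Num.bound (a / c)); exact: archi_boundP (divr_ge0 a0 (ltW c0)).
exists n.+1 => //; have -> : n.+1%:R = (n.+1%:R)%:C%C :> R[i] by rewrite rmorph_nat.
rewrite lecE /= !mulr0 !mul0r subr0 addr0 eqxx /= mulrC -ler_pdivrMr //.
by rewrite (le_trans (ltW an)) // ler_nat.
Qed.

Lemma unit_Re_le1 w : `|w| = 1 -> complex.Re w <= 1.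
Proof.
move=> w1; rewrite -lecR rmorph1 -w1; apply: le_trans (normc_ge_Re w).
by rewrite lecR ler_norm.
Qed.

Lemma unit_Re_geN1 w : `|w| = 1 -> -1 <= complex.Re w.
Proof.
move=> w1; rewrite lerNl -lecR rmorph1 -w1; apply: le_trans (normc_ge_Re w).
by rewrite lecR -normrN ler_norm.
Qed.

Lemma unit_Re_eq1 w : `|w| = 1 -> complex.Re w = 1 -> w = 1.
Proof.
move=> w1 Rw; have := add_Re2_Im2 w; rewrite w1 Rw expr1n => /complexI/eqP.
rewrite expr1n eq_sym -subr_eq0 opprD addNKr oppr_eq0 sqrf_eq0 => /eqP Iw.
by case: w Rw Iw {w1} => a b /= -> ->.
Qed.

Lemma unit_addV w : `|w| = 1 -> w + w^-1 = (2 * complex.Re w)%:C%C.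
Proof.
by move=> w1; rewrite invC_norm w1 expr1n invr1 mul1r [LHS]addcJ rmorphM rmorph_nat.
Qed.

End UnitComplex.

(** * Trigonometric polynomials and their twists *)

Section Characters.
Context {R : realType} {G : topologicalZmodType}.
Implicit Types (chi psi : G -> R[i]) (x y : G).

Lemma character0 chi : is_character chi -> chi 0 = 1.
Proof.
move=> [_ chi1 chiM]; have chi0 : chi 0 != 0 by rewrite -normr_eq0 chi1 oner_eq0.
by apply: (mulfI chi0); rewrite -chiM addr0 mulr1.
Qed.

Lemma characterN chi x : is_character chi -> chi (- x) = (chi x)^-1.
Proof.
move=> chiP; have [_ chi1 chiM] := chiP.
have chi0 : chi x != 0 by rewrite -normr_eq0 chi1 oner_eq0.
by apply: (mulfI chi0); rewrite -chiM subrr character0 // divff.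
Qed.

Lemma character_mulrn chi x n : is_character chi -> chi (x *+ n) = chi x ^+ n.
Proof.
move=> chiP; elim: n => [|n IH]; first by rewrite character0.
by rewrite mulrS exprS; case: chiP => _ _ ->; rewrite IH.
Qed.

Lemma is_character1 : is_character (fun=> 1 : R[i]) (G := G).
Proof. by split=> [|x|x y]; [exact: cst_continuous|rewrite normr1|rewrite mulr1]. Qed.

Lemma is_characterM chi psi : is_character chi -> is_character psi ->
  is_character (fun x => chi x * psi x).
Proof.
move=> [cchi chi1 chiM] [cpsi psi1 psiM]; split=> [x|x|x y].
- by apply: (@cvgM _ _ _ _ (chi : G -> R[i]^o) (psi : G -> R[i]^o)); [exact: cchi|exact: cpsi].
- by rewrite normrM chi1 psi1 mulr1.
- by rewrite chiM psiM mulrACA.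
Qed.

Lemma is_characterV chi : is_character chi -> is_character (fun x => (chi x)^-1).
Proof.
move=> chiP; have [cchi chi1 chiM] := chiP; split=> [|x|x y].
- have -> : (fun x => (chi x)^-1) = chi \o -%R.
    by apply/funext => x /=; rewrite characterN.
  by move=> x; apply: continuous_comp; [exact: opp_continuous|exact: cchi].
- by rewrite normfV chi1 invr1.
- by rewrite chiM invfM.
Qed.

(** Trigonometric polynomials without constant term. This replaces the vanishing of the mean value
    and avoids integration; the list is explicit so that inductions can run over it. *)
Fixpoint nontrivial_comb (s : seq (G -> R[i])) (g : G -> R[i]) : Prop :=
  if s is chi :: s' then exists c h,
    [/\ is_character chi, exists x, chi x != 1, nontrivial_comb s' h &
        forall x, g x = c * chi x + h x]
  else forall x, g x = 0.

(** Translation multiplies each coefficient by a constant, so averages keep the same list of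
    characters. *)
Lemma nontrivial_comb_sum s g k n x0 : nontrivial_comb s g ->
  nontrivial_comb s (fun x => k * \sum_(t < n) g (x + x0 *+ t)).
Proof.
elim: s g => [|chi s IH] g /=; first by move=> g0 x; rewrite big1 ?mulr0.
move=> [c [h [chiP nt /IH hs gE]]]; exists (k * c * \sum_(t < n) chi (x0 *+ t)).
eexists; split; [by []|by []|exact: hs|] => x.
have [_ _ chiM] := chiP.
under eq_bigr do rewrite gE chiM mulrA.
by rewrite big_split /= mulrDr -mulr_sumr mulrA -!mulrA [chi x * _]mulrC.
Qed.

Lemma nontrivial_combD s t g h : nontrivial_comb s g -> nontrivial_comb t h ->
  nontrivial_comb (s ++ t) (fun x => g x + h x).
Proof.
move=> + ht; elim: s g => [|chi s IH] g /= gs.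
  by rewrite (_ : (fun x => _) = h) //; apply/funext => x; rewrite gs add0r.
case: gs => c [g' [chiP nt /IH gs gE]]; exists c, (fun x => g' x + h x); split=> // x.
by rewrite gE addrA.
Qed.

(* Averaging over the multiples of a point [x0] where the first character
   differs from [1] makes its contribution arbitrarily small; this goes into
   the error term [e]. *)
Lemma nontrivial_comb_le s g e eps c : nontrivial_comb s g -> 0 <= c ->
  (forall x, `|e x| <= eps) -> (forall x, c <= g x + e x) -> c <= eps.
Proof.
move=> + c0; elim: s g e eps => [|chi s IH] g e eps /= gs ee cge.
  have := cge 0; rewrite gs add0r => ce.
  by rewrite (le_trans ce) // -(ger0_norm (le_trans c0 ce)).
case: gs => a [h [chiP [x0 nt] hs gE]]; apply/ler_addgt0Pr => eta eta0.
have [_ chi1 chiM] := chiP.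
have z0 : 0 < `|chi x0 - 1| by rewrite normr_gt0 subr_eq0.
(* This [n] makes the averaged first term at most [eta], as a geometric sum bounds it by
   [2 * |a| / (n * |chi x0 - 1|)]. *)
have [n n0 nP] := @complex_archimedean R (`|a| * 2) (eta * `|chi x0 - 1|)
  (mulr_ge0 (normr_ge0 _) (ler0n _ _)) (mulr_gt0 eta0 z0).
have nR : 0 < n%:R :> R[i] by rewrite ltr0n.
have sz : `|\sum_(t < n) chi (x0 *+ t)| <= 2 / `|chi x0 - 1|.
  rewrite ler_pdivlMr // mulrC -normrM.
  under eq_bigr do rewrite character_mulrn //.
  rewrite -subrX1 (le_trans (ler_normB _ _)) //.
  by rewrite normrX chi1 expr1n normr1.
apply: (IH _ (fun x => n%:R^-1 * \sum_(t < n) e (x + x0 *+ t) +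
   n%:R^-1 * (a * chi x * \sum_(t < n) chi (x0 *+ t))) _
   (@nontrivial_comb_sum s h n%:R^-1 n x0 hs)) => x.
  apply: le_trans (ler_normD _ _) _; apply: lerD.
    rewrite normrM normfV normr_nat ler_pdivrMl //.
    apply: le_trans (ler_norm_sum _ _ _) _.
    apply: (@le_trans _ _ (\sum_(t < n) eps)); first exact: ler_sum.
    by rewrite sumr_const card_ord mulr_natl.
  rewrite normrM normfV normr_nat ler_pdivrMl // !normrM chi1 mulr1.
  apply: le_trans (ler_wpM2l (normr_ge0 _) sz) _.
  by rewrite mulrA ler_pdivrMr // [n%:R * eta]mulrC mulrAC.
have -> : n%:R^-1 * \sum_(t < n) h (x + x0 *+ t) +
   (n%:R^-1 * \sum_(t < n) e (x + x0 *+ t) +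
    n%:R^-1 * (a * chi x * \sum_(t < n) chi (x0 *+ t))) =
   n%:R^-1 * \sum_(t < n) (g (x + x0 *+ t) + e (x + x0 *+ t)).
  under [in RHS]eq_bigr do rewrite gE chiM mulrA.
  rewrite !big_split /= -mulr_sumr !mulrDr; ring.
rewrite ler_pdivlMl //; apply: (@le_trans _ _ (\sum_(t < n) c)).
  by rewrite sumr_const card_ord mulr_natl.
exact: ler_sum.
Qed.

(** The graph of a homomorphism from a group of characters to the circle. The last clause makes it
    single-valued: the quotient of two values at one character is a value at the trivial one. *)
Definition partial_hom (L : set ((G -> R[i]) * R[i])) :=
  [/\ forall chi z, L (chi, z) -> is_character chi /\ `|z| = 1,
      L (fun=> 1, 1),
      forall chi z psi w, L (chi, z) -> L (psi, w) -> L (fun x => chi x * psi x, z * w),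
      forall chi z, L (chi, z) -> L (fun x => (chi x)^-1, z^-1) &
      forall z, L (fun=> 1, z) -> z = 1].

(** [Q] arises from [P] by multiplying each character by its value under [L]. This is a relation
    because the function [P] does not record its expression in characters. *)
Inductive twist (L : set ((G -> R[i]) * R[i])) : (G -> R[i]) -> (G -> R[i]) -> Prop :=
| twist0 : twist L (fun=> 0) (fun=> 0)
| twistS c chi z P Q : L (chi, z) -> twist L P Q ->
    twist L (fun x => c * chi x + P x) (fun x => c * (z * chi x) + Q x).

#[local] Arguments twistS {L} c {chi z P Q}.

Section Twist.
Context {L : set ((G -> R[i]) * R[i])}.
Context (LP : partial_hom L).

Lemma twist_ext {P Q P' Q'} : twist L P Q -> P =1 P' -> Q =1 Q' -> twist L P' Q'.
Proof. by move=> + /funext <- /funext <-. Qed.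

Lemma twist_gen c {chi z} : L (chi, z) ->
  twist L (fun x => c * chi x) (fun x => c * (z * chi x)).
Proof.
move=> Lz; apply: twist_ext (twistS c Lz (twist0 L)) _ _ => x; exact: addr0.
Qed.

Lemma twistD {P Q P' Q'} : twist L P Q -> twist L P' Q' ->
  twist L (fun x => P x + P' x) (fun x => Q x + Q' x).
Proof.
move=> + PQ'; elim=> [|c chi z {}P {}Q Lz _ IH].
  by apply: twist_ext PQ' _ _ => x; rewrite add0r.
by apply: twist_ext (twistS c Lz IH) _ _ => x; exact: addrA.
Qed.

Lemma twistM {P Q P' Q'} : twist L P Q -> twist L P' Q' ->
  twist L (fun x => P x * P' x) (fun x => Q x * Q' x).
Proof.
case: LP => _ _ LM _ _.
have step c chi z : L (chi, z) -> twist L P' Q' ->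
    twist L (fun x => c * chi x * P' x) (fun x => c * (z * chi x) * Q' x).
  move=> Lz; elim=> [|d psi w {}P' {}Q' Lw _ IH].
    by apply: twist_ext (twist0 L) _ _ => x; rewrite mulr0.
  by apply: twist_ext (twistS (c * d) (LM _ _ _ _ Lz Lw) IH) _ _ => x; ring.
move=> + PQ'; elim=> [|c chi z {}P {}Q Lz _ IH].
  by apply: twist_ext (twist0 L) _ _ => x; rewrite mul0r.
by apply: twist_ext (twistD (step c _ _ Lz PQ') IH) _ _ => x; rewrite mulrDl.
Qed.

Lemma twist_cst c : twist L (fun=> c) (fun=> c).
Proof.
case: LP => _ L1 _ _ _; apply: twist_ext (twist_gen c L1) _ _ => x;
  by rewrite !mulr1.
Qed.

Lemma twistX {P Q} n : twist L P Q -> twist L (fun x => P x ^+ n) (fun x => Q x ^+ n).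
Proof.
move=> PQ; elim: n => [|n IH]; first exact: twist_cst.
by apply: twist_ext (twistM PQ IH) _ _ => x; rewrite exprS.
Qed.

(** The trivial character has value [1] under [L], so its terms cancel in the difference: twisting
    preserves the constant term. *)
Lemma twist_comb {P Q} : twist L P Q ->
  exists s, nontrivial_comb s (fun x => P x - Q x).
Proof.
case: LP => LC _ _ _ Leq1; elim=> [|c chi z {}P {}Q Lz _ [s hs]].
  by exists [::] => x; rewrite subrr.
have [chi1|/existsNP[x0 nt]] := pselect (forall x, chi x = 1).
  have chiE : chi = fun=> 1 by apply/funext.
  rewrite chiE in Lz; rewrite (Leq1 _ Lz); exists s.
  rewrite (_ : (fun x => _) = fun x => P x - Q x) //.
  by apply/funext => x; rewrite chi1; ring.
exists (chi :: s); exists (c * (1 - z)), (fun x => P x - Q x); split=> //.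
- exact: (LC _ _ Lz).1.
- by exists x0; apply/eqP.
- by move=> x; ring.
Qed.

End Twist.
End Characters.

Lemma compact_closed_meet {T : topologicalType} {I : choiceType} (D : set I)
    (f : I -> set T) : compact [set: T] -> (forall i, D i -> closed (f i)) ->
    finI D f -> exists x, forall i, D i -> f i x.
Proof.
(* The empty subfamily shows that [T] is nonempty, which supplies the base point of a pointed
   type. *)
move=> cT fcl finf; have [x0 _] := finf fset0 (fun _ h => ltac:(by [])).
pose PT : ptopologicalType := HB.pack T (isPointed.Build T x0).
have cPT : compact [set: PT] by [].
move: cPT; rewrite compact_In0 => /(_ I D f)[||x xf]; last by exists x.
  by exists f => // i _; rewrite setTI.
exact: finf.
Qed.

Section Translates.
Context {G : topologicalZmodType}.

Lemma translate_continuous (y : G) : continuous (fun x => x - y).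
Proof.
move=> x; apply: (@continuous_comp _ _ _ (fun x => (x, y)) (fun x : G * G => x.1 - x.2)).
  by apply: cvg_pair; [exact: cvg_id|exact: cvg_cst].
exact: sub_continuous.
Qed.

Lemma compact_translates (U : set G) : compact [set: G] -> open U -> U 0 ->
  exists s : seq G, forall x, exists2 y, y \in s & U (x - y).
Proof.
move=> cG oU U0.
pose PG : ptopologicalType := HB.pack G (isPointed.Build G 0).
have cPG : compact [set: PG] by [].
move: cPG; rewrite compact_cover.
move=> /(_ G setT (fun y => (fun x => x - y) @^-1` U))[y _|x _|s _ sP].
- by apply: open_comp => // x _; exact: translate_continuous.
- by exists x => //=; rewrite subrr.
by exists s => x; have [y ys Uy] := sP x I; exists y.
Qed.

End Translates.

(** * Bohr's argument and evaluation at a point *)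

Section Eval.
Context {R : realType} {G : topologicalZmodType}.
Implicit Types (l : seq ((G -> R[i]) * R[i])) (L : set ((G -> R[i]) * R[i])).

(* [2 + 2 * Re w] is [w + 2 + w^-1] for [|w| = 1], with maximum [4] attained
   only at [w = 1]. *)
Definition trig l (x : G) : R := \sum_(p <- l) (2 + 2 * complex.Re (p.2 * p.1 x)).

Lemma Re_continuous : continuous (@complex.Re R : R[i]^o -> R).
Proof.
move=> z; have zF : Filter (nbhs (z : R[i]^o)) by exact: nbhs_filter.
apply: (iffRL (@cvgrPdist_lt R R^o R[i]^o (nbhs (z : R[i]^o)) zF
  (@complex.Re R) (complex.Re z))).
move=> e e0 {zF}.
exists e%:C%C => [|w zw]; first by rewrite /= ltcR.
rewrite /= -ltcR; have -> : complex.Re z - complex.Re w = complex.Re (z - w : R[i]).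
  by case: (z) (w) => ? ? [].
exact: le_lt_trans (normc_ge_Re _) zw.
Qed.

Lemma trig_continuous l : (forall p, p \in l -> is_character p.1) -> continuous (trig l).
Proof.
elim: l => [|[chi z] l IH] lP.
  rewrite (_ : trig [::] = fun=> 0); first exact: cst_continuous.
  by apply/funext => x; rewrite /trig big_nil.
rewrite (_ : trig _ = fun x => 2 + 2 * complex.Re (z * chi x) + trig l x); last first.
  by apply/funext => x; rewrite /trig big_cons.
have [cchi _ _] : is_character chi by apply: (lP (chi, z)); rewrite inE eqxx.
move=> x; apply: cvgD; last by apply: IH => p pl; apply: lP; rewrite inE pl orbT.
apply: cvgD; first exact: cvg_cst.
apply: cvgM; first exact: cvg_cst.
apply: (@continuous_comp _ _ _ (fun x => z * chi x : R[i]^o) (@complex.Re R));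
  last exact: Re_continuous.
by apply: (@cvgM _ _ _ _ (fun=> z : R[i]^o) (chi : G -> R[i]^o)); [exact: cvg_cst|exact: cchi].
Qed.

Lemma trig_cons (chi : G -> R[i]) (z : R[i]) l x : `|z * chi x| = 1 ->
  (trig ((chi, z) :: l) x)%:C%C = 2 + z * chi x + (z * chi x)^-1 + (trig l x)%:C%C.
Proof.
move=> w1; rewrite /trig big_cons rmorphD /=; congr (_ + _).
by rewrite -[RHS]addrA (unit_addV _ w1) rmorphD rmorph_nat.
Qed.

Lemma trig_twist L l : partial_hom L -> {subset l <= L} ->
  twist L (fun x => (trig [seq (p.1, 1) | p <- l] x)%:C%C) (fun x => (trig l x)%:C%C).
Proof.
move=> LP; elim: l => [_|[chi z] l IH lL].
  by apply: twist_ext (twist0 L) _ _ => x; rewrite /trig big_nil.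
have Lz : L (chi, z) by apply/set_mem/lL; rewrite inE eqxx.
have [LC _ _ LV _] := LP; have [[_ chi1 _] z1] := LC _ _ Lz.
have {}IH : twist L _ _ := IH (fun p pl => lL p (mem_behead (s := _ :: l) pl)).
have PQ := twistD (twistD (twistD (twist_cst LP 2) (twist_gen 1 Lz))
  (twist_gen 1 (LV _ _ Lz))) IH.
apply: twist_ext PQ _ _ => x; rewrite trig_cons ?normrM ?chi1 ?z1 ?normr1 ?mulr1 //=.
  by rewrite !mul1r.
by rewrite !mul1r invfM.
Qed.

(** Twisting along it replaces [chi x] by [chi (x - y)], so translates can be compared with twists
    along [L]. *)
Lemma evaluation_partial_hom (y : G) :
  partial_hom [set q : (G -> R[i]) * R[i] | is_character q.1 /\ q.2 = (q.1 y)^-1].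
Proof.
split=> [chi z [/= chiP ->]||
    chi z psi w [/= chiP ->] [/= psiP ->]|chi z [/= chiP ->]|z [/= _ ->]].
- by split=> //; case: chiP => _ chi1 _; rewrite normfV chi1 invr1.
- by split; [exact: is_character1|rewrite /= invr1].
- by split; [exact: is_characterM|rewrite /= invfM].
- by split; [exact: is_characterV|].
- by rewrite invr1.
Qed.

Lemma nontrivial_combZ (s : seq (G -> R[i])) g k :
  nontrivial_comb s g -> nontrivial_comb s (fun x => k * g x).
Proof.
move=> /(nontrivial_comb_sum _ _ k 1 0); congr nontrivial_comb; apply/funext => x.
by rewrite big_ord1 mulr0n addr0.
Qed.

(** After raising to a power, one larger value outweighs [C] smaller ones; [C] will be the number of
    translates. *)
Lemma geometric_dominated (C : nat) (a b : R) : 0 <= a -> a < b ->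
  exists n, C%:R * a ^+ n < b ^+ n.
Proof.
move=> a0 ab; have b0 : 0 < b by exact: le_lt_trans ab.
have ab1 : `|a / b| < 1 by rewrite ger0_norm ?divr_ge0 ?(ltW b0) // ltr_pdivrMr // mul1r.
have /cvgrPdist_lt/(_ C.+1%:R^-1) := cvg_expr ab1.
rewrite invr_gt0 ltr0n => /(_ isT)[n _ /(_ n (leqnn n))] /=.
rewrite sub0r normrN ger0_norm ?exprn_ge0 ?divr_ge0 ?(ltW b0) // => abn.
exists n; have bn : 0 < b ^+ n by rewrite exprn_gt0.
move: abn; rewrite expr_div_n ltr_pdivrMr // ltr_pdivlMl ?ltr0n //.
by apply: le_lt_trans; rewrite ler_wpM2r ?exprn_ge0 // ler_nat.
Qed.

(* Suppose that [trig l] stays below its formal maximum [M].  The average of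
   a power of [trig l] depends only on the relations between the characters,
   hence is the same for all translates of [trig l] with trivial
   coefficients; but finitely many of these jointly exceed some [b] larger
   than [sup (trig l)] everywhere. *)
Lemma partial_hom_trig_max L l : compact [set: G] -> partial_hom L ->
  {subset l <= L} -> exists x, forall p, p \in l -> p.2 * p.1 x = 1.
Proof.
move=> cG LP lL; have [LC _ _ _ _] := LP.
have lC p : p \in l -> is_character p.1 by case: p => chi z /lL/set_mem/LC[].
have lu p x : p \in l -> `|p.2 * p.1 x| = 1.
  by case: p => chi z /lL/set_mem/LC[[_ chi1 _] z1]; rewrite normrM chi1 z1 mulr1.
pose M : R := \sum_(p <- l) 4.
have [||c _ cmax] := @compact_EVT_max G R (trig l) setT _ cG.
- by exists 0.
- exact/continuous_subspaceT/trig_continuous.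
have {}cmax x : trig l x <= trig l c by apply: cmax; rewrite inE.
(* If the formal maximum is attained, every summand equals [4], so every real part is [1]. *)
have [Mc|cM] := leP M (trig l c).
  exists c => p pl; apply: unit_Re_eq1; first exact: lu.
  have le4 q : q \in l -> 0 <= 4 - (2 + 2 * complex.Re (q.2 * q.1 c)).
    by move=> /(lu _ c)/unit_Re_le1; lra.
  have : \sum_(q <- l | q \in l) (4 - (2 + 2 * complex.Re (q.2 * q.1 c))) == 0.
    rewrite eq_le sumr_ge0 // andbT -big_seq sumrB subr_le0; exact: Mc.
  rewrite psumr_eq0 // => /allP/(_ p pl); rewrite pl /= => /eqP; lra.
exfalso; pose l1 : seq ((G -> R[i]) * R[i]) := [seq (p.1, 1) | p <- l].
pose ly y : seq ((G -> R[i]) * R[i]) := [seq (p.1, (p.1 y)^-1) | p <- l].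
have ge0_term (w : R[i]) : `|w| = 1 -> 0 <= 2 + 2 * complex.Re w.
  by move=> /unit_Re_geN1; lra.
have trig0 x : 0 <= trig l x.
  by rewrite /trig big_seq sumr_ge0 // => p /(lu _ x)/ge0_term.
have trig_ly y x : trig (ly y) x = trig l1 (x - y).
  rewrite /trig !big_map big_seq [RHS]big_seq; apply: eq_bigr => p /lC pC /=.
  by have [_ _ ->] := pC; rewrite characterN // mul1r [_^-1 * _]mulrC.
have ly0 y x : 0 <= trig (ly y) x.
  rewrite /trig big_map big_seq sumr_ge0 // => p /lC[_ p1 _]; apply: ge0_term.
  by rewrite /= normrM normfV !p1 invr1 mulr1.
pose b := (trig l c + M) / 2.
have cb : trig l c < b by rewrite /b; lra.
(* At [0] the value of [trig l1] is [M], which exceeds [b]; so among finitely many translates one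
   exceeds [b] at each point. *)
have [||s sP] := @compact_translates G [set x | b < trig l1 x] cG.
- apply: (@open_comp _ _ (trig l1) [set u | b < u]) => [x _|]; last exact: open_gt.
  by apply: trig_continuous => _ /mapP[p /lC pC ->].
- rewrite /= (_ : trig l1 0 = M); first by rewrite /b; lra.
  rewrite /trig big_map /M big_seq [RHS]big_seq; apply: eq_bigr => p /lC pC /=.
  by rewrite character0 // mulr1 /=; lra.
have [n nP] := @geometric_dominated (size s) _ _ (trig0 c) cb.
(* Both powers in a summand are twists of [trig l1 ^+ n], along the evaluation and along [L], so
   their difference has no constant term. *)
pose g (t : seq G) x := (\sum_(y <- t) (trig (ly y) x ^+ n - trig l x ^+ n))%:C%C.
have [u gu] : exists u, nontrivial_comb u (g s).
  elim: {sP nP} s => [|y s [u gu]].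
    by exists [::] => x; rewrite /g big_nil.
  have [v1 h1] := twist_comb LP (twistX LP n (trig_twist L l LP lL)).
  have [|v2 h2] := twist_comb (evaluation_partial_hom y)
     (twistX (evaluation_partial_hom y) n (trig_twist _ (ly y) (evaluation_partial_hom y) _)).
    by move=> _ /mapP[p /lC pC ->]; apply/mem_set.
  have := nontrivial_combD _ _ _ _
    (nontrivial_combD _ _ _ _ h1 (nontrivial_combZ _ _ (-1) h2)) gu.
  move=> h; eexists; move: h; congr nontrivial_comb; apply/funext => x.
  rewrite /g big_cons rmorphD rmorphB !rmorphXn /= -map_comp; ring.
(* At every point one translate contributes at least [b ^+ n], so [g s] has a positive lower bound
   although it has no constant term. *)
suff : (b ^+ n - (size s)%:R * trig l c ^+ n)%:C%C <= 0 :> R[i].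
  by rewrite lecR leNgt subr_gt0 nP.
apply: (nontrivial_comb_le _ _ (fun=> 0) _ _ gu) => [|x|x].
- by rewrite lecR subr_ge0 ltW.
- by rewrite normr0.
rewrite addr0 /g lecR sumrB big_const_seq count_predT iter_addr_0.
apply: lerB; last by rewrite -[leLHS]mulr_natl ler_wpM2l // lerXn2r ?nnegrE.
have [y ys /= bx] := sP x; rewrite (big_rem y) //= trig_ly.
rewrite -[X in X <= _]addr0 lerD ?sumr_ge0 // => [|z _]; last exact: exprn_ge0.
have b0 : 0 <= b by exact: le_trans (trig0 c) (ltW cb).
by rewrite lerXn2r ?nnegrE ?(ltW bx) // (le_trans b0) // ltW.
Qed.

(** Each condition defines a closed set, so by compactness it is enough to satisfy finitely many at
    a time. *)
Lemma partial_hom_eval L : compact [set: G] -> partial_hom L ->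
  exists x : G, forall chi z, L (chi, z) -> chi x = z.
Proof.
move=> cG LP; have [LC _ _ _ _] := LP.
have [||x xP] := @compact_closed_meet G _ L (fun p => [set x | p.1 x = p.2]) cG.
- move=> [chi z] /LC[[cchi _ _] _] /=.
  apply: (@closed_comp _ _ (chi : G -> R[i]^o) [set z]) => [x _|]; first exact: cchi.
  exact/accessible_closed_set1/hausdorff_accessible/norm_hausdorff.
- move=> D' D'L; have [|x xP] := partial_hom_trig_max L (enum_fset D') cG LP.
    by move=> p /D'L.
  (* The point found satisfies [z * chi x = 1], so at its opposite [chi] takes the value [z]. *)
  exists (- x) => -[chi z] pD /=.
  have [chiP z1] := LC _ _ (set_mem (D'L _ pD)).
  rewrite characterN //; have [_ chi1 _] := chiP.
  have chi0 : chi x != 0 by rewrite -normr_eq0 chi1 oner_eq0.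
  by apply: (mulIf chi0); rewrite mulVf // -(xP _ pD).
by exists x => chi z; exact: xP.
Qed.

End Eval.

(** * Characters modulo torsion *)

(** In characteristic zero [X^n - 1] has [n] distinct roots, and a finite group of roots of unity in
    a field is cyclic. *)
Lemma primitive_root_exists {C : numClosedFieldType} (n : nat) : (0 < n)%N ->
  exists z : C, n.-primitive_root z.
Proof.
move=> n0; pose p : {poly C} := 'X^n - 1; have [r Dp] := closed_field_poly_normal p.
rewrite (monicP _) ?monicXnsubC // scale1r in Dp.
have rn1 : all n.-unity_root r by apply/allP => z; rewrite -root_prod_XsubC -Dp.
have sz_r : (n < (size r).+1)%N by rewrite -(size_prod_XsubC r id) -Dp size_XnsubC.
have [|z] := hasP (cyclic.has_prim_root n0 rn1 _ sz_r); last by exists z.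
rewrite -separable.separable_prod_XsubC -Dp.
by rewrite cyclotomic.separable_Xn_sub_1 // pnatr_eq0 -lt0n.
Qed.

Section CharacterGroup.
Context {R : realType} {G : topologicalZmodType}.

(** Made into an additive group below so that the results on [zspan] apply; its addition is the
    multiplication of characters. *)
Definition character_group := {chi : G -> R[i] | is_character chi}.

HB.instance Definition _ := gen_eqMixin character_group.
HB.instance Definition _ := gen_choiceMixin character_group.

Implicit Types (chi psi xi : character_group).

Lemma character_group_eq chi psi : (forall x, sval chi x = sval psi x) -> chi = psi.
Proof. by case: chi psi => chi chiP [psi psiP] /= /funext; exact: eq_exist. Qed.

Definition character_group_zero : character_group := exist _ _ is_character1.
Definition character_group_add chi psi : character_group :=
  exist _ _ (is_characterM _ _ (svalP chi) (svalP psi)).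
Definition character_group_opp chi : character_group :=
  exist _ _ (is_characterV _ (svalP chi)).

Fact character_group_addA : associative character_group_add.
Proof. by move=> chi psi xi; apply: character_group_eq => x; exact: mulrA. Qed.

Fact character_group_addC : commutative character_group_add.
Proof. by move=> chi psi; apply: character_group_eq => x; exact: mulrC. Qed.

Fact character_group_add0 : left_id character_group_zero character_group_add.
Proof. by move=> chi; apply: character_group_eq => x; exact: mul1r. Qed.

Fact character_group_addN :
  left_inverse character_group_zero character_group_opp character_group_add.
Proof.
move=> chi; apply: character_group_eq => x; apply: mulVf.
by case: (svalP chi) => _ chi1 _; rewrite -normr_eq0 chi1 oner_eq0.
Qed.

HB.instance Definition _ := GRing.isZmodule.Build character_group
  character_group_addA character_group_addC character_group_add0 character_group_addN.

Lemma sval_mulrn chi n x : sval (chi *+ n) x = sval chi x ^+ n.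
Proof. by elim: n => // n IH; rewrite mulrS exprS -IH. Qed.

(** The values of [phi] are powers of a primitive root. The divisibility hypothesis on the exponents
    makes the induced map on the subgroup generated by [F] single-valued; a point that evaluates it
    interpolates [phi]. *)
Lemma independent_is_PR (N : nat) (F : set character_group) : (0 < N)%N ->
    compact [set: G] ->
    (forall phi : character_group -> int, (forall chi, ~ F chi -> phi chi = 0) ->
      forall a, zspan [set (chi, phi chi) | chi in F] (0, a) -> (N %| a)%Z) ->
  is_PR N [set sval chi | chi in F].
Proof.
move=> N0 cG indF phi phiN; have [z zN] := @primitive_root_exists R[i] N N0.
have z1 : `|z| = 1.
  apply/eqP; rewrite -(@pexpr_eq1 _ _ N) //.
  by rewrite -normrX (prim_expr_order zN) normr1.
have z0 : z != 0 by rewrite -normr_eq0 z1 oner_eq0.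
have /boolp.choice[a aP] chi : exists a : int,
    (F chi -> phi (sval chi) = z ^ a) /\ (~ F chi -> a = 0).
  have [Fchi|nF] := pselect (F chi); last by exists 0.
  have [|i ->] := prim_rootP zN (x := phi (sval chi)); last by exists i.
  by apply: phiN; exists chi.
pose Gr := zspan [set (chi, a chi) | chi in F].
pose L := [set (sval p.1, z ^ p.2) | p in Gr].
have LP : partial_hom L.
  split.
  - move=> _ _ [[chi k] _ [<- <-]]; split; first exact: svalP.
    by case: k => k; rewrite ?NegzE -?exprnN ?normfV normrX z1 expr1n ?invr1.
  - by exists 0 => //; exact: zspan0.
  - move=> _ _ _ _ [p Gp [<- <-]] [q Gq [<- <-]]; exists (p + q); first exact: zspanD.
    by rewrite /= expfzDr.
  - move=> _ _ [p Gp [<- <-]]; exists (- p); first exact: zspanN.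
    by rewrite /= invr_expz.
  - move=> w [[chi k] Gp [/= chi1 <-]].
    have chi0 : chi = 0 by apply: character_group_eq => x; rewrite chi1.
    rewrite chi0 in Gp; have /dvdzP[l ->] : (N %| k)%Z.
      by apply: indF Gp => psi; exact: (aP psi).2.
    by rewrite mulrC -exprz_exp -exprnP (prim_expr_order zN) exp1rz.
have [x xP] := partial_hom_eval L cG LP.
exists x => _ [chi Fchi <-]; rewrite (aP chi).1 //; apply/esym/xP.
by exists (chi, a chi) => //; apply: zspan_gen; exists chi.
Qed.

End CharacterGroup.
#[global] Arguments character_group : clear implicits.

(** * Classes modulo the torsion subgroups *)

Section TorsionQuotient.
Context {R : realType} {G : topologicalZmodType}.

(** Any exponent that kills [h] and is not divisible by [m] will do, since the order divides it. *)
Lemma Gamma_ndP m (h : G -> R[i]) : Gamma_nd m h <-> is_character h /\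
  exists j, [/\ (0 < j)%N, ~~ (m %| j)%N & forall x, h x ^+ j = 1].
Proof.
split=> [[hC [k [[k0 hk _] mk]]]|[hC [j [j0 mj hj]]]]; first by split=> //; exists k.
split=> //; have exj : exists j, (0 < j)%N && `[< forall x, h x ^+ j = 1 >].
  by exists j; rewrite j0; apply/asboolP.
case: (ex_minnP exj) => k /andP[k0 /asboolP hk] kmin; exists k; split.
  by split=> // i i0 hi; apply: kmin; rewrite i0; apply/asboolP.
apply: contra mj => /dvdn_trans; apply; rewrite /dvdn; apply: contrapT => /negP r0.
suff : (k <= j %% k)%N by rewrite leqNgt ltn_pmod.
apply: kmin; rewrite lt0n r0; apply/asboolP => x; have := hj x.
by rewrite {1}(divn_eq j k) exprD mulnC exprM hk expr1n mul1r.
Qed.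

Lemma Gamma_nd1 m : (1 < m)%N -> Gamma_nd m (fun=> 1 : R[i]) (G := G).
Proof.
move=> m1; apply/Gamma_ndP; split; first exact: is_character1.
by exists 1%N; split=> [||x]; rewrite ?expr1n // dvdn1 gtn_eqF.
Qed.

(** The [p]-adic valuation of a least common multiple is the larger of the two valuations, hence
    still below [n]. *)
Lemma Gamma_ndM p n (g h : G -> R[i]) : prime p -> Gamma_nd (p ^ n) g ->
  Gamma_nd (p ^ n) h -> Gamma_nd (p ^ n) (fun x => g x * h x).
Proof.
move=> pp /Gamma_ndP[gC [j [j0 pj gj]]] /Gamma_ndP[hC [k [k0 pk hk]]].
apply/Gamma_ndP; split; first exact: is_characterM.
exists (lcmn j k); split; first by rewrite lcmn_gt0 j0.
  move: pj pk; rewrite !pfactor_dvdn ?lcmn_gt0 ?j0 // logn_lcm // -!ltnNge gtn_max.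
  by move=> -> ->.
move=> x; rewrite exprMn; have /dvdnP[c cE] := dvdn_lcml j k.
have /dvdnP[d dE] := dvdn_lcmr j k.
by rewrite {1}cE dE mulnC exprM gj expr1n mulnC exprM hk expr1n mulr1.
Qed.

Lemma quot_map_eq p n (chi psi h : G -> R[i]) : prime p -> Gamma_nd (p ^ n) h ->
  (forall x, chi x = psi x * h x) -> quot_map (p ^ n) chi `<=` quot_map (p ^ n) psi.
Proof.
move=> pp hG chiE _ [g gG <-]; exists (fun x => h x * g x); first exact: Gamma_ndM.
by apply/funext => x; rewrite chiE mulrA.
Qed.

Lemma quot_map_character p n (chi psi : character_group R G) m : prime p ->
    ~~ (p ^ n %| m)%N -> (chi - psi) *+ m = 0 ->
  quot_map (p ^ n) (sval chi) = quot_map (p ^ n) (sval psi).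
Proof.
move=> pp pm xym.
have Gm (u v : character_group R G) : (u - v) *+ m = 0 -> Gamma_nd (p ^ n) (sval (u - v)).
  move=> uvm; apply/Gamma_ndP; split; first exact: svalP.
  (* [m] is positive because [0] is divisible by [p ^ n]. *)
  exists m; split=> // [|x]; first by apply: contraNT pm; rewrite -eqn0Ngt => /eqP ->.
  by rewrite -sval_mulrn uvm.
apply/seteqP; split.
  apply: quot_map_eq pp (Gm _ _ xym) _ => x.
  by rewrite -[LHS]/(sval chi x) -{1}[chi](subrKC psi).
have yxm : (psi - chi) *+ m = 0 by rewrite -opprB mulNrn xym oppr0.
apply: quot_map_eq pp (Gm _ _ yxm) _ => x.
by rewrite -{1}[psi](subrKC chi).
Qed.

Lemma is_PR_quot_map_inj p n (F : set (G -> R[i])) : prime p -> (0 < n)%N ->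
  is_PR (p ^ n) F -> set_inj F (quot_map (p ^ n)).
Proof.
move=> pp n0 PRF chi psi /set_mem Fchi /set_mem Fpsi qE.
have N1 : (1 < p ^ n)%N by rewrite -(expn0 p) ltn_exp2l // prime_gt1.
have [h hG hE] : quot_map (p ^ n) psi chi.
  rewrite -qE; exists (fun=> 1); first exact: Gamma_nd1.
  by apply/funext => x; rewrite mulr1.
apply: contrapT => chipsi; have [z zN] := @primitive_root_exists R[i] _ (ltnW N1).
(* With a primitive root prescribed at [chi] and [1] elsewhere, [h x] is that root, so [p ^ n]
   divides every exponent killing [h]. *)
have [|x xP] := PRF (fun g => if pselect (g = chi) is left _ then z else 1).
  by move=> g _; case: pselect => _; rewrite ?expr1n // prim_expr_order.
have := xP _ Fpsi; have := xP _ Fchi.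
case: pselect => // _ zE; case: pselect => [/esym //|_ psi1].
have /Gamma_ndP[_ [j [_ /negP nj hj]]] := hG; apply: nj.
rewrite (prim_order_dvd zN) zE -hE -psi1 mul1r hj; exact: eqxx.
Qed.

End TorsionQuotient.

(** * Sizes of PR subsets and of sets of classes *)

Theorem theorem4p3 (R : realType) (G : topologicalZmodType)
  (HGcpt : compact [set: G]) (HGhaus : hausdorff_space G)
  (E : set (G -> R[i])) (HE : E `<=` @dual R G) (Hunc : ~ countable E)
  (p n : nat) (Hp : prime p) (Hn : (0 < n)%N) :
  (exists F : set (G -> R[i]),
      [/\ F `<=` E, is_PR (p ^ n)%N F & F #= E]) <->
  (@quot_map R G (p ^ n)%N @` E #= E).
Proof.
split=> [[F [FE PRF FEc]]|qE].
  have /card_eqPle[_ EFle] := FEc.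
  rewrite card_eq_le card_image_le /=; apply: card_le_trans EFle _.
  have /card_eqPle[_ FqF] := inj_card_eq (is_PR_quot_map_inj p n F Hp Hn PRF).
  by apply: card_le_trans FqF _; exact/subset_card_le/image_subset.
(* [E] is moved to the character group, where [independent_subset] applies; [sval] is injective, so
   cardinals are unchanged. *)
pose E' : set (character_group R G) := [set chi | E (sval chi)].
have svalE' : sval @` E' = E.
  apply/seteqP; split=> [_ [chi Echi <-] //|chi Echi].
  by exists (exist _ chi (HE _ Echi)).
have svalc (A : set (character_group R G)) : sval @` A #= A.
  by apply: inj_card_eq => chi psi _ _ e; apply: character_group_eq => x; rewrite e.
have [||F [FE' FE'c indF]] := @independent_subset _ _
    (fun chi : character_group R G => quot_map (p ^ n) (sval chi)) (p ^ n) E'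
    (fun chi psi m => quot_map_character p n chi psi m Hp).
- by move=> cE'; apply: Hunc; rewrite -svalE' (eq_countable (svalc E')).
- rewrite (_ : [set _ | chi in E'] = quot_map (p ^ n) @` E).
    rewrite -(card_le_eql (svalc E')) svalE'.
    by have /card_eqPle[] := qE.
  by rewrite -svalE' image_comp.
exists (sval @` F); split.
- by rewrite -svalE'; exact: image_subset.
- by apply: independent_is_PR => //; rewrite expn_gt0 prime_gt0.
- apply: card_eq_trans (svalc F) _; apply: card_eq_trans FE'c _.
  by rewrite -svalE' card_eq_sym; exact: svalc.
Qed.
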